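(* Let $A(y,z)$ be a formula of £ with free variables $y,z$. Put $\mathbf a\equiv\{\langle y,z\rangle\mid A(y,\{w\mid\langle w,z\rangle\in z\})\}$ and $[\![A]\!]\equiv\{v\mid\langle v,\mathbf a\rangle\in\mathbf a\}$. Then $$\Vdash^M\forall x\big(x\in[\![A]\!]\leftrightarrow\mathcal T\,\mathcal T\,A(x,[\![A]\!])\big).$$
   Context: The language of the librationist theory £: variables; primitive set constants $\mathcal T$ (truth set) and $\mathcal F$; atomic formulas $a\in b$; formulas $\downarrow AB$ (joint denial), $\forall vA$; terms $\{v\mid A\}$; name terms $\ulcorner X\urcorner$. $\neg A:=\downarrow AA$, other connectives and $\exists$ classical; $\mathcal TA$ abbreviates $\ulcorner A\urcorner\in\mathcal T$. Identity: $a=b:\equiv\forall u(a\in u\to b\in u)$; $\{a,b\}\equiv\{x\mid x=a\vee x=b\}$, $\{a\}\equiv\{a,a\}$, $\langle a,b\rangle\equiv\{\{a\},\{a,b\}\}$, and $\{\langle y,z\rangle\mid B\}\equiv\{u\mid\exists y\exists z(u=\langle y,z\rangle\wedge B)\}$. Semantics: for each $n\in\omega$ and ordinal $\alpha$ a full set $\models^\alpha_n$ of formulas ($\downarrow AB$ in it iff neither $A$ nor $B$; $\forall vA$ in it iff all substitution instances $A^b_v$ are); $(\models^0_n)_n$ a fixed enumeration of full sets; for $\alpha>0$, $\mathcal TA\in\models^\alpha_n$ iff for some $\gamma<\alpha$, $A\in\models^\delta_n$ for all $\gamma\le\delta<\alpha$, and $a\in\{x\mid A\}\in\models^\alpha_n$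 iff $\mathcal TA^a_x\in\models^\alpha_n$. $\models^\alpha B$ iff $B\in\models^\alpha_n$ for all $n$. $\mathrm{IN}^\alpha(A)$ iff $\models^\beta\mathcal TA$ for all $\beta\ge\alpha$; $\mathrm{IN}(A)$ iff $\exists\alpha\,\mathrm{IN}^\alpha(A)$; $\alpha$ stabilizes $A$ iff ($\mathrm{IN}(A)\Rightarrow\mathrm{IN}^\alpha(A)$) and ($\models^\alpha\mathcal TA\Rightarrow\mathrm{IN}(A)$); $\varpi$ is the least ordinal stabilizing every sentence. $\Vdash^MA$ iff $\mathcal TA\in\models^\varpi_n$ for all $n$. *)

(* Defs.v *)
From mathcomp Require Import all_boot.

Set Implicit Arguments.
Unset Strict Implicit.
Unset Printing Implicit Defensive.

(* Expressions are de Bruijn terms, so they are taken up to renaming of bound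
   variables.  [Abs] (for {v | A}) and [All] each bind the index 0. *)
Inductive term : Type :=
| Var (i : nat)
| cT
| cF
| Abs (A : formula)
| NameT (t : term)
| NameF (A : formula)
with formula : Type :=
| In (a b : term)
| Nor (A B : formula)
| All (A : formula).

Definition upren (r : nat -> nat) (i : nat) : nat :=
  if i is j.+1 then (r j).+1 else 0.

Fixpoint tren (r : nat -> nat) (t : term) : term :=
  match t with
  | Var i => Var (r i)
  | cT => cT
  | cF => cF
  | Abs A => Abs (fren (upren r) A)
  | NameT s => NameT (tren r s)
  | NameF A => NameF (fren r A)
  end
with fren (r : nat -> nat) (A : formula) : formula :=
  match A with
  | In a b => In (tren r a) (tren r b)
  | Nor B C => Nor (fren r B) (fren r C)
  | All B => All (fren (upren r) B)
  end.

Definition tlift (t : term) : term := tren succn t.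

Definition upsub (s : nat -> term) (i : nat) : term :=
  if i is j.+1 then tlift (s j) else Var 0.

(* Substitution acts inside name terms: in [forall x, T A(x)] the quantifier
   binds the x occurring in the name of A(x). *)
Fixpoint tsub (s : nat -> term) (t : term) : term :=
  match t with
  | Var i => s i
  | cT => cT
  | cF => cF
  | Abs A => Abs (fsub (upsub s) A)
  | NameT u => NameT (tsub s u)
  | NameF A => NameF (fsub s A)
  end
with fsub (s : nat -> term) (A : formula) : formula :=
  match A with
  | In a b => In (tsub s a) (tsub s b)
  | Nor B C => Nor (fsub s B) (fsub s C)
  | All B => All (fsub (upsub s) B)
  end.

(* A^b_v, where v is the variable 0 of the body A of a binder. *)
Definition inst (A : formula) (b : term) : formula :=
  fsub (fun i => if i is j.+1 then Var j else b) A.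

(* All free indices are < k. *)
Fixpoint tbelow (k : nat) (t : term) : bool :=
  match t with
  | Var i => i < k
  | cT => true
  | cF => true
  | Abs A => fbelow k.+1 A
  | NameT s => tbelow k s
  | NameF A => fbelow k A
  end
with fbelow (k : nat) (A : formula) : bool :=
  match A with
  | In a b => tbelow k a && tbelow k b
  | Nor B C => fbelow k B && fbelow k C
  | All B => fbelow k.+1 B
  end.

Definition sentence (A : formula) : bool := fbelow 0 A.

Definition Neg (A : formula) : formula := Nor A A.
Definition Or (A B : formula) : formula := Neg (Nor A B).
Definition And (A B : formula) : formula := Nor (Neg A) (Neg B).
Definition Imp (A B : formula) : formula := Or (Neg A) B.
Definition Iff (A B : formula) : formula := And (Imp A B) (Imp B A).
Definition Ex (A : formula) : formula := Neg (All (Neg A)).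

Definition Tr (A : formula) : formula := In (NameF A) cT.

Definition Eq (a b : term) : formula :=
  All (Imp (In (tlift a) (Var 0)) (In (tlift b) (Var 0))).

Definition upair (a b : term) : term :=
  Abs (Or (Eq (Var 0) (tlift a)) (Eq (Var 0) (tlift b))).
Definition sing (a : term) : term := upair a a.
Definition opair (a b : term) : term := upair (sing a) (upair a b).

(* {<y,z> | B} = {u | exists y z, u = <y,z> /\ B}.  In B, y is the index 1 and
   z the index 0; the renaming skips u, which becomes the index 2. *)
Definition pair_compr (B : formula) : term :=
  Abs (Ex (Ex (And (Eq (Var 2) (opair (Var 1) (Var 0)))
                   (fren (upren (upren succn)) B)))).

(* A(s,t) for a formula A(y,z) with y the index 1 and z the index 0; other
   variables are left alone. *)
Definition app2 (A : formula) (s t : term) : formula :=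
  fsub (fun i => match i with 0 => t | 1 => s | _ => Var i end) A.

(* {<y,z> | A(y, {w | <w,z> \in z})} *)
Definition diag (A : formula) : term :=
  pair_compr
    (app2 A (Var 1) (Abs (In (opair (Var 0) (Var 1)) (Var 1)))).

(* [[A]] = {v | <v,a> \in a} with a = diag A *)
Definition manif (A : formula) : term :=
  Abs (In (opair (Var 0) (tlift (diag A))) (tlift (diag A))).

(* Ordinals as well-founded trees: [osup f] denotes sup_i (f i + 1).  Several
   trees denote one ordinal; equality of ordinals is [oeq]. *)
Inductive Ord : Type := osup (X : Type) (f : X -> Ord).

Fixpoint ole (a b : Ord) : Prop :=
  match a, b with
  | osup X f, osup Y g => forall i : X, exists j : Y, ole (f i) (g j)
  end.

Definition olt (a b : Ord) : Prop :=
  match b with osup Y g => exists j : Y, ole a (g j) end.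

Definition oeq (a b : Ord) : Prop := ole a b /\ ole b a.

Definition ozero : Ord := osup (fun i : void => match i with end).

Definition full (S : formula -> Prop) : Prop :=
  (forall A B, S (Nor A B) <-> ~ S A /\ ~ S B) /\
  (forall A, S (All A) <-> forall b, S (inst A b)).

(* [M al n A] is A \in |=^al_n.  [(M ozero n)_n] is an arbitrary sequence of
   full sets. *)
Record librationist (M : Ord -> nat -> formula -> Prop) : Prop := Librationist {
  lib_oeq : forall al be n A, oeq al be -> (M al n A <-> M be n A);
  lib_full : forall al n, full (M al n);
  lib_Tr : forall al n A, olt ozero al ->
    (M al n (Tr A) <->
     exists ga, olt ga al /\
       forall de, ole ga de -> olt de al -> M de n A);
  lib_Abs : forall al n a A, olt ozero al ->
    (M al n (In a (Abs A)) <-> M al n (Tr (inst A a)))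
}.

Definition models (M : Ord -> nat -> formula -> Prop) (al : Ord)
    (B : formula) : Prop :=
  forall n, M al n B.

Definition IN_from (M : Ord -> nat -> formula -> Prop) (al : Ord)
    (A : formula) : Prop :=
  forall be, ole al be -> models M be (Tr A).

Definition IN (M : Ord -> nat -> formula -> Prop) (A : formula) : Prop :=
  exists al, IN_from M al A.

Definition stabilizes (M : Ord -> nat -> formula -> Prop) (al : Ord)
    (A : formula) : Prop :=
  (IN M A -> IN_from M al A) /\ (models M al (Tr A) -> IN M A).

Definition stabilizes_all (M : Ord -> nat -> formula -> Prop) (al : Ord) :
    Prop :=
  forall A, sentence A -> stabilizes M al A.

Definition is_varpi (M : Ord -> nat -> formula -> Prop) (w : Ord) : Prop :=
  stabilizes_all M w /\ forall al, stabilizes_all M al -> ole w al.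

(* The definite description of varpi is unfolded, so its existence is part of
   the assertion. *)
Definition forcesM (M : Ord -> nat -> formula -> Prop) (A : formula) : Prop :=
  exists w, is_varpi M w /\ forall n, M w n (Tr A).

(* Main.v *)
Require Import Defs.
From mathcomp Require Import all_boot.
From Stdlib Require Import Classical IndefiniteDescription.

(** Call [s] and [t] indiscernible if no formula separates them at any stage.
    If some formula [B] separates [s] and [t] at a stage [de], then [s = t]
    fails at every stage [ga > de]: as [s = s] and [B(s) <-> B(s)] always hold,
    [s = t] at [ga] makes both [s = t] and [B(s) <-> B(t)] hold at all large
    enough stages below [ga], and one descends to [de].  There are only
    set-many pairs of terms, so from some stage [ka] on equality implies
    indiscernibility.  From there on ordered pairs can be inverted, and
    unfolding the two comprehensions, each of which costs one [Tr], gives the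
    equivalence.  It thus holds at all large stages, and stabilization brings
    it down to varpi.  That varpi exists is a closure argument: a sentence that
    is not [IN] is refuted cofinally often along one fixed index [n], so the
    supremum of a suitable omega-sequence of stages stabilizes everything. *)

Set Implicit Arguments.
Unset Strict Implicit.
Unset Printing Implicit Defensive.

(** * Substitution *)

Scheme term_mut := Induction for term Sort Prop
with formula_mut := Induction for formula Sort Prop.
Combined Scheme term_formula_ind from term_mut, formula_mut.

(** Reduces an identity between substitutions into a formula [A(y,z)] to a check at the two indices
    0 and 1. *)
Lemma sub_eq_below :
  (forall t k s1 s2, tbelow k t -> (forall i, i < k -> s1 i = s2 i) ->
     tsub s1 t = tsub s2 t) /\
  (forall A k s1 s2, fbelow k A -> (forall i, i < k -> s1 i = s2 i) ->
     fsub s1 A = fsub s2 A).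
Proof.
have up k s1 s2 : (forall i, i < k -> s1 i = s2 i) ->
    forall i, i < k.+1 -> upsub s1 i = upsub s2 i.
  by move=> e [|i] //= /e ->.
apply: term_formula_ind => //=.
- by move=> i k s1 s2 lt_ik; apply.
- by move=> A IH k s1 s2 bA /up e; rewrite (IH _ _ _ bA e).
- by move=> t IH k s1 s2 bt e; rewrite (IH _ _ _ bt e).
- by move=> A IH k s1 s2 bA e; rewrite (IH _ _ _ bA e).
- move=> a IHa b IHb k s1 s2 /andP[ba bb] e.
  by rewrite (IHa _ _ _ ba e) (IHb _ _ _ bb e).
- move=> A IHA B IHB k s1 s2 /andP[bA bB] e.
  by rewrite (IHA _ _ _ bA e) (IHB _ _ _ bB e).
- by move=> A IH k s1 s2 bA /up e; rewrite (IH _ _ _ bA e).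
Qed.

Lemma sub_ext :
  (forall t s1 s2, s1 =1 s2 -> tsub s1 t = tsub s2 t) /\
  (forall A s1 s2, s1 =1 s2 -> fsub s1 A = fsub s2 A).
Proof.
have up s1 s2 : s1 =1 s2 -> upsub s1 =1 upsub s2 by move=> e [|i] //=; rewrite e.
apply: term_formula_ind => //=.
- by move=> A IH s1 s2 /up/IH ->.
- by move=> t IH s1 s2 /IH ->.
- by move=> A IH s1 s2 /IH ->.
- by move=> a IHa b IHb s1 s2 e; rewrite (IHa _ _ e) (IHb _ _ e).
- by move=> A IHA B IHB s1 s2 e; rewrite (IHA _ _ e) (IHB _ _ e).
- by move=> A IH s1 s2 /up/IH ->.
Qed.

Lemma ren_sub :
  (forall t r, tren r t = tsub (fun i => Var (r i)) t) /\
  (forall A r, fren r A = fsub (fun i => Var (r i)) A).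
Proof.
have up r : (fun i => Var (upren r i)) =1 upsub (fun i => Var (r i)) by case.
apply: term_formula_ind => //=.
- by move=> A IH r; rewrite IH (proj2 sub_ext _ _ _ (up r)).
- by move=> t IH r; rewrite IH.
- by move=> A IH r; rewrite IH.
- by move=> a IHa b IHb r; rewrite IHa IHb.
- by move=> A IHA B IHB r; rewrite IHA IHB.
- by move=> A IH r; rewrite IH (proj2 sub_ext _ _ _ (up r)).
Qed.

Lemma sub_ren :
  (forall t s r, tsub s (tren r t) = tsub (fun i => s (r i)) t) /\
  (forall A s r, fsub s (fren r A) = fsub (fun i => s (r i)) A).
Proof.
have up s r : (fun i => upsub s (upren r i)) =1 upsub (fun i => s (r i)) by case.
apply: term_formula_ind => //=.
- by move=> A IH s r; rewrite IH (proj2 sub_ext _ _ _ (up s r)).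
- by move=> t IH s r; rewrite IH.
- by move=> A IH s r; rewrite IH.
- by move=> a IHa b IHb s r; rewrite IHa IHb.
- by move=> A IHA B IHB s r; rewrite IHA IHB.
- by move=> A IH s r; rewrite IH (proj2 sub_ext _ _ _ (up s r)).
Qed.

Lemma tlift_tren r t : tren (upren r) (tlift t) = tlift (tren r t).
Proof.
by rewrite /tlift (proj1 ren_sub _ (upren r)) (proj1 sub_ren)
  (proj1 ren_sub (tren r t)) (proj1 sub_ren).
Qed.

Lemma tren_upsub r s i :
  tren (upren r) (upsub s i) = upsub (fun j => tren r (s j)) i.
Proof. by case: i => //= i; rewrite tlift_tren. Qed.

(** Fusion with renamings precedes [sub_sub]: under a binder [upsub] shifts by a renaming, so a
    substitution must first be known to commute with [tlift]. *)
Lemma ren_of_sub :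
  (forall t r s, tren r (tsub s t) = tsub (fun i => tren r (s i)) t) /\
  (forall A r s, fren r (fsub s A) = fsub (fun i => tren r (s i)) A).
Proof.
apply: term_formula_ind => //=.
- by move=> A IH r s; rewrite IH (proj2 sub_ext _ _ _ (tren_upsub r s)).
- by move=> t IH r s; rewrite IH.
- by move=> A IH r s; rewrite IH.
- by move=> a IHa b IHb r s; rewrite IHa IHb.
- by move=> A IHA B IHB r s; rewrite IHA IHB.
- by move=> A IH r s; rewrite IH (proj2 sub_ext _ _ _ (tren_upsub r s)).
Qed.

Lemma tsub_upsub_tlift s t : tsub (upsub s) (tlift t) = tlift (tsub s t).
Proof. by rewrite /tlift (proj1 sub_ren) (proj1 ren_of_sub). Qed.

Lemma tsub_upsub s u i :
  tsub (upsub s) (upsub u i) = upsub (fun j => tsub s (u j)) i.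
Proof. by case: i => //= i; rewrite tsub_upsub_tlift. Qed.

Lemma sub_sub :
  (forall t s u, tsub s (tsub u t) = tsub (fun i => tsub s (u i)) t) /\
  (forall A s u, fsub s (fsub u A) = fsub (fun i => tsub s (u i)) A).
Proof.
apply: term_formula_ind => //=.
- by move=> A IH s u; rewrite IH (proj2 sub_ext _ _ _ (tsub_upsub s u)).
- by move=> t IH s u; rewrite IH.
- by move=> A IH s u; rewrite IH.
- by move=> a IHa b IHb s u; rewrite IHa IHb.
- by move=> A IHA B IHB s u; rewrite IHA IHB.
- by move=> A IH s u; rewrite IH (proj2 sub_ext _ _ _ (tsub_upsub s u)).
Qed.

Lemma sub_Var :
  (forall t, tsub Var t = t) /\ (forall A, fsub Var A = A).
Proof.
have up : upsub Var =1 Var by case.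
apply: term_formula_ind => //=.
- by move=> A IH; rewrite (proj2 sub_ext _ _ _ up) IH.
- by move=> t ->.
- by move=> A ->.
- by move=> a -> b ->.
- by move=> A -> B ->.
- by move=> A IH; rewrite (proj2 sub_ext _ _ _ up) IH.
Qed.

(** The substitution inside [inst], named so that [inst A b] is [fsub (sub0 b) A] by conversion and
    terms get the counterpart [tinst]. *)
Definition sub0 (b : term) (i : nat) : term := if i is j.+1 then Var j else b.

Definition tinst (t b : term) : term := tsub (sub0 b) t.

Lemma tinst_tlift t b : tinst (tlift t) b = t.
Proof. by rewrite /tinst /tlift (proj1 sub_ren) (proj1 sub_Var). Qed.

Lemma inst_flift A b : inst (fren succn A) b = A.
Proof. by rewrite /inst (proj2 sub_ren) (proj2 sub_Var). Qed.

Lemma fsub_And s A B : fsub s (And A B) = And (fsub s A) (fsub s B).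
Proof. by []. Qed.

Lemma fsub_Eq s a b : fsub s (Eq a b) = Eq (tsub s a) (tsub s b).
Proof. by rewrite /Eq /= !tsub_upsub_tlift. Qed.

Lemma tsub_upair s a b : tsub s (upair a b) = upair (tsub s a) (tsub s b).
Proof.
rewrite /upair -!tsub_upsub_tlift.
(* The bound variable is written as its own image, so that [fsub_Eq] can be folded back. *)
by rewrite -[Var 0 in RHS]/(tsub (upsub s) (Var 0)) -!fsub_Eq.
Qed.

Lemma tsub_opair s a b : tsub s (opair a b) = opair (tsub s a) (tsub s b).
Proof. by rewrite /opair /sing !tsub_upair. Qed.

(** * Bounds on free indices *)

Lemma below_ren :
  (forall t k j r, tbelow k t -> (forall i, i < k -> r i < j) ->
     tbelow j (tren r t)) /\
  (forall A k j r, fbelow k A -> (forall i, i < k -> r i < j) ->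
     fbelow j (fren r A)).
Proof.
have up k j r : (forall i, i < k -> r i < j) ->
    forall i, i < k.+1 -> upren r i < j.+1 by move=> h [|i] //=; apply: h.
apply: term_formula_ind => //=.
- by move=> i k j r ik; apply.
- by move=> A IH k j r bA /up; apply: IH.
- by move=> a IHa b IHb k j r /andP[ba bb] h; rewrite (IHa k) ?(IHb k).
- by move=> a IHa b IHb k j r /andP[ba bb] h; rewrite (IHa k) ?(IHb k).
- by move=> A IH k j r bA /up; apply: IH.
Qed.

Lemma tbelow_tlift k t : tbelow k t -> tbelow k.+1 (tlift t).
Proof. by move=> bt; apply: (proj1 below_ren _ k). Qed.

Lemma below_sub :
  (forall t k j s, tbelow k t -> (forall i, i < k -> tbelow j (s i)) ->
     tbelow j (tsub s t)) /\
  (forall A k j s, fbelow k A -> (forall i, i < k -> tbelow j (s i)) ->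
     fbelow j (fsub s A)).
Proof.
have up k j s : (forall i, i < k -> tbelow j (s i)) ->
    forall i, i < k.+1 -> tbelow j.+1 (upsub s i).
  by move=> h [|i] //= /h; apply: tbelow_tlift.
apply: term_formula_ind => //=.
- by move=> i k j s ik; apply.
- by move=> A IH k j s bA /up; apply: IH.
- by move=> a IHa b IHb k j s /andP[ba bb] h; rewrite (IHa k) ?(IHb k).
- by move=> a IHa b IHb k j s /andP[ba bb] h; rewrite (IHa k) ?(IHb k).
- by move=> A IH k j s bA /up; apply: IH.
Qed.

Lemma fbelow_Or k A B : fbelow k A -> fbelow k B -> fbelow k (Or A B).
Proof. by move=> bA bB; rewrite /= bA bB. Qed.

Lemma fbelow_And k A B : fbelow k A -> fbelow k B -> fbelow k (And A B).
Proof. by move=> bA bB; rewrite /= bA bB. Qed.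

Lemma fbelow_Iff k A B : fbelow k A -> fbelow k B -> fbelow k (Iff A B).
Proof. by move=> bA bB; rewrite /= bA bB. Qed.

Lemma fbelow_Ex k A : fbelow k.+1 A -> fbelow k (Ex A).
Proof. by move=> bA; rewrite /= bA. Qed.

Lemma fbelow_Eq k a b : tbelow k a -> tbelow k b -> fbelow k (Eq a b).
Proof. by move=> ba bb; rewrite /Eq /= !tbelow_tlift. Qed.

Lemma tbelow_upair k a b : tbelow k a -> tbelow k b -> tbelow k (upair a b).
Proof.
move=> ba bb.
change (fbelow k.+1 (Or (Eq (Var 0) (tlift a)) (Eq (Var 0) (tlift b)))).
by apply: fbelow_Or; apply: fbelow_Eq => //; apply: tbelow_tlift.
Qed.

Lemma tbelow_opair k a b : tbelow k a -> tbelow k b -> tbelow k (opair a b).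
Proof. by move=> ba bb; rewrite /opair /sing !tbelow_upair. Qed.

(** * Ordinals *)

Lemma ole_refl a : ole a a.
Proof. by elim: a => X f IH /= i; exists i. Qed.

Lemma ole_trans a b c : ole a b -> ole b c -> ole a c.
Proof.
elim: a b c => X f IH [Y g] [Z h] /= le_fg le_gh i.
have [j le_ij] := le_fg i; have [k le_jk] := le_gh j.
by exists k; apply: IH le_jk.
Qed.

Lemma ole_lt_trans a b c : ole a b -> olt b c -> olt a c.
Proof. by case: c => Z h le_ab [j le_bj]; exists j; apply: ole_trans le_bj. Qed.

Lemma olt_le_trans a b c : olt a b -> ole b c -> olt a c.
Proof.
case: b c => Y g [Z h] [j le_aj] /(_ j)[k le_jk].
by exists k; apply: ole_trans le_jk.
Qed.

Lemma olt_osup X (f : X -> Ord) i : olt (f i) (osup f).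
Proof. by exists i; apply: ole_refl. Qed.

Lemma olt_ole a b : olt a b -> ole a b.
Proof.
elim: a b => X f IH [Y g] [j le_aj] /= i.
by exists j; apply: IH; apply: olt_le_trans le_aj; apply: olt_osup.
Qed.

(** If [osup f] is not below [osup g], some [f i] is below no [g j]; by induction every [g j] is
    then strictly below [f i], so [osup g] is at most [f i]. *)
Lemma ole_or_olt a b : ole a b \/ olt b a.
Proof.
elim: a b => X f IH [Y g]; have [le_ab|nle] := classic (ole (osup f) (osup g)).
  by left.
right; have [i nle_i] := not_all_ex_not _ _ nle.
exists i; have lt_g j : olt (g j) (f i).
  by have [le_ij|//] := IH i (g j); case: nle_i; exists j.
by case: (f i) lt_g => Z h lt_g j; apply: lt_g.
Qed.

Lemma ole0 a : ole ozero a.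
Proof. by case: a => X f []. Qed.

Definition osucc (a : Ord) : Ord := osup (fun _ : unit => a).

Lemma olt_osucc a : olt a (osucc a).
Proof. by exists tt; apply: ole_refl. Qed.

Lemma exists_omax (a b c : Ord) : olt a c -> olt b c ->
  exists d, [/\ ole a d, ole b d & olt d c].
Proof.
move=> lt_ac lt_bc; case: (ole_or_olt a b) => [le_ab|/olt_ole le_ba].
  by exists b; split=> //; apply: ole_refl.
by exists a; split=> //; apply: ole_refl.
Qed.

Lemma olt_ind (P : Ord -> Prop) :
  (forall a, (forall b, olt b a -> P b) -> P a) -> forall a, P a.
Proof.
(* A smaller ordinal need not be a subtree, only at most one; hence the strengthening to all [b] at
   most [a]. *)
move=> IH a; suff: forall b, ole b a -> P b by apply; apply: ole_refl.
elim: a => X f IHf b le_b; apply: IH => c lt_cb.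
by have [i /IHf] := olt_le_trans lt_cb le_b.
Qed.

Lemma exists_least (P : Ord -> Prop) a : P a ->
  exists w, P w /\ forall b, P b -> ole w b.
Proof.
elim/olt_ind: a => a IH Pa.
have [[b [lt_ba /(IH b lt_ba)]]//|nlt] := classic (exists b, olt b a /\ P b).
exists a; split=> // b Pb; case: (ole_or_olt a b) => // lt_ba.
by case: nlt; exists b.
Qed.

(** * Full sets *)

Lemma full_Neg S A : full S -> S (Neg A) <-> ~ S A.
Proof. by case=> hN _; rewrite hN; tauto. Qed.

Lemma full_Or S A B : full S -> S (Or A B) <-> S A \/ S B.
Proof. by move=> hS; rewrite full_Neg // (proj1 hS); tauto. Qed.

Lemma full_And S A B : full S -> S (And A B) <-> S A /\ S B.
Proof. by move=> hS; rewrite (proj1 hS) !full_Neg //; tauto. Qed.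

Lemma full_Imp S A B : full S -> S (Imp A B) <-> (S A -> S B).
Proof. by move=> hS; rewrite full_Or // full_Neg //; tauto. Qed.

Lemma full_Iff S A B : full S -> S (Iff A B) <-> (S A <-> S B).
Proof. by move=> hS; rewrite full_And // !full_Imp //. Qed.

Lemma full_Ex S A : full S -> S (Ex A) <-> exists b, S (inst A b).
Proof.
move=> hS; rewrite full_Neg // (proj2 hS); split.
  move=> /not_all_ex_not[b]; rewrite -[inst (Neg A) b]/(Neg (inst A b)) full_Neg //.
  by move=> /NNPP Sb; exists b.
move=> [b Sb] /(_ b); rewrite -[inst (Neg A) b]/(Neg (inst A b)) full_Neg //.
Qed.

Lemma full_Eq S a b : full S ->
  S (Eq a b) <-> forall u, S (In a u) -> S (In b u).
Proof.
move=> hS; rewrite (proj2 hS).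
have e u : inst (Imp (In (tlift a) (Var 0)) (In (tlift b) (Var 0))) u =
    Imp (In a u) (In b u).
  rewrite -[LHS]/(Imp (In (tinst (tlift a) u) u) (In (tinst (tlift b) u) u)).
  by rewrite !tinst_tlift.
by split=> h u; have := h u; rewrite e full_Imp.
Qed.

(** * Stages *)

Lemma lib_Tr_succ M al n A : librationist M ->
  M (osucc al) n (Tr A) <-> M al n A.
Proof.
move=> hM; have lt0 : olt ozero (osucc al).
  by apply: ole_lt_trans (ole0 al) (olt_osucc al).
rewrite (lib_Tr hM) //; split=> [[ga [[_ le_ga] h]]|hA].
  by apply: h => //; apply: olt_osucc.
exists al; split=> [|de le_al [_ le_de]]; first exact: olt_osucc.
(* [de] may be a different tree for the ordinal [al]. *)
by apply/(lib_oeq hM n A (al := al) (be := de)).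
Qed.

(** [Tr] depends only on a tail of the stages below [al], and the threshold can be raised to
    [ka]. *)
Lemma lib_Tr_congr M ka al n A B : librationist M -> olt ka al ->
  (forall de, ole ka de -> (M de n A <-> M de n B)) ->
  (M al n (Tr A) <-> M al n (Tr B)).
Proof.
move=> hM lt_ka eAB; have lt0 : olt ozero al by apply: ole_lt_trans lt_ka; apply: ole0.
rewrite !(lib_Tr hM) //; split=> -[ga [lt_ga h]];
  have [d [le_ga le_kd lt_d]] := exists_omax lt_ga lt_ka;
  exists d; split=> // de le_de lt_de; apply/eAB;
  try apply: h lt_de; exact: ole_trans le_de.
Qed.

(** Identity only transfers memberships; applied to the set [Abs C] it gives substitution of equals
    under one [Tr]. *)
Lemma lib_Eq_Tr M al n s t C : librationist M -> olt ozero al ->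
  M al n (Eq s t) -> M al n (Tr (inst C s)) -> M al n (Tr (inst C t)).
Proof.
move=> hM lt0; rewrite full_Eq; last exact: lib_full hM _ _.
by move=> /(_ (Abs C)); rewrite !(lib_Abs hM).
Qed.

Lemma lib_Eq_refl M al n s : librationist M -> M al n (Eq s s).
Proof. by move=> hM; rewrite full_Eq; last exact: lib_full hM _ _. Qed.

Lemma inst_Eq_tlift s t : inst (Eq (tlift s) (Var 0)) t = Eq s t.
Proof. by rewrite /inst fsub_Eq -/(tinst (tlift s) t) tinst_tlift. Qed.

Lemma not_Eq_after M de ga n B s t : librationist M ->
  ~ (M de n (inst B s) <-> M de n (inst B t)) -> olt de ga ->
  ~ M ga n (Eq s t).
Proof.
move=> hM dist; elim/olt_ind: ga => ga IH lt_de eq_st.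
have lt0 : olt ozero ga by apply: ole_lt_trans lt_de; apply: ole0.
have always C : (forall al, M al n C) -> M ga n (Tr C).
  by move=> hC; rewrite (lib_Tr hM) //; exists ozero.
(* The right side is shifted past the variable, so replacing [s] by [t] in the tautology [inst C s]
   affects the left side alone. *)
pose C := Iff B (fren succn (inst B s)).
have instC u : inst C u = Iff (inst B u) (inst B s).
  by rewrite -[LHS]/(Iff (inst B u) (inst (fren succn (inst B s)) u)) inst_flift.
have : M ga n (Tr (inst C t)).
  apply: lib_Eq_Tr eq_st _ => //; apply: always => al.
  by rewrite instC full_Iff //; apply: lib_full hM _ _.
have : M ga n (Tr (inst (Eq (tlift s) (Var 0)) t)).
  apply: lib_Eq_Tr eq_st _ => //; apply: always => al.
  by rewrite inst_Eq_tlift; apply: lib_Eq_refl.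
rewrite inst_Eq_tlift !(lib_Tr hM) // => -[g1 [lt1 h1]] [g2 [lt2 h2]].
(* Either the equivalence already holds at [de], against [dist], or [de] is below [g2] and the
   identity recurs at a stage [d] strictly between [de] and [ga]. *)
case: (ole_or_olt g2 de) => [le2|lt_de2].
  have := h2 _ le2 lt_de; rewrite instC full_Iff; last exact: lib_full hM _ _.
  by move=> e; apply: dist; rewrite e.
have [d [le1d le2d lt_d]] := exists_omax lt1 lt2.
by apply: (IH d) (h1 _ le1d _) => //; apply: olt_le_trans le2d.
Qed.

(** * Indiscernibility of terms *)

Definition indisc (M : Ord -> nat -> formula -> Prop) (n : nat) (s t : term) :
    Prop :=
  forall de B, M de n (inst B s) <-> M de n (inst B t).

Lemma indisc_sym M n s t : indisc M n s t -> indisc M n t s.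
Proof. by move=> h de B; rewrite h. Qed.

Lemma indisc_trans M n s t u :
  indisc M n s t -> indisc M n t u -> indisc M n s u.
Proof. by move=> h1 h2 de B; rewrite h1 h2. Qed.

Lemma indisc_Eq M al n s t : librationist M ->
  indisc M n s t -> M al n (Eq s t).
Proof.
move=> hM /(_ al (Eq (tlift s) (Var 0))); rewrite !inst_Eq_tlift => <-.
exact: lib_Eq_refl.
Qed.

(** A separating stage is chosen for each triple of an index and two terms; these triples form a
    type, so [osup] bounds all the choices. Indiscernible pairs get the default [ozero]. *)
Lemma eventually_Eq_indisc M : librationist M ->
  exists ka, forall ga n s t, ole ka ga -> M ga n (Eq s t) -> indisc M n s t.
Proof.
move=> hM.
have sep (p : nat * term * term) : exists de, forall ga, olt de ga ->
    M ga p.1.1 (Eq p.1.2 p.2) -> indisc M p.1.1 p.1.2 p.2.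
  case: p => [[n s] t] /=; have [i_st|ni] := classic (indisc M n s t).
    by exists ozero.
  have [de /not_all_ex_not[B dist]] := not_all_ex_not _ _ ni.
  by exists de => ga lt_ga /(not_Eq_after hM dist lt_ga).
have [f hf] := functional_choice _ sep.
exists (osup f) => ga n s t le_ga; apply: (hf (n, s, t)).
by apply: olt_le_trans le_ga; apply: olt_osup.
Qed.

(** * Ordered pairs *)

Lemma lib_In_upair M al n u s t : librationist M ->
  M (osucc al) n (In u (upair s t)) <-> M al n (Eq u s) \/ M al n (Eq u t).
Proof.
move=> hM; rewrite (lib_Abs hM); last first.
  by apply: ole_lt_trans (ole0 al) (olt_osucc al).
rewrite lib_Tr_succ // -full_Or; last exact: lib_full hM _ _.
rewrite -[inst _ u]/(Or (inst (Eq (Var 0) (tlift s)) u)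
                        (inst (Eq (Var 0) (tlift t)) u)).
by rewrite /inst !fsub_Eq -!/(tinst (tlift _) _) !tinst_tlift.
Qed.

Lemma indisc_upair M ka n s t s' t' : librationist M ->
  (forall s t, M ka n (Eq s t) -> indisc M n s t) ->
  indisc M n (upair s t) (upair s' t') ->
  indisc M n s s' /\ indisc M n t t' \/ indisc M n s t' /\ indisc M n t s'.
Proof.
move=> hM hka hp.
(* Membership at [osucc ka] is identity at [ka], where identity and indiscernibility coincide. *)
have memE u a b :
    M (osucc ka) n (In u (upair a b)) <-> indisc M n u a \/ indisc M n u b.
  rewrite lib_In_upair //; split=> -[h|h]; [left|right|left|right];
    by [apply: hka | apply: indisc_Eq].
have mem u : indisc M n u s \/ indisc M n u t <->
    indisc M n u s' \/ indisc M n u t'.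
  rewrite -!memE; have := hp (osucc ka) (In (tlift u) (Var 0)).
  by rewrite /inst /= -!/(tinst (tlift u) _) !tinst_tlift.
have refl u : indisc M n u u by [].
have sy := @indisc_sym M n; have tr := @indisc_trans M n.
case: ((mem s).1 (or_introl (refl s))) => hs;
  (* The two open cases match [s] and [t] with the same element of the other pair; its remaining
     element is then traced back through [mem]. *)
  case: ((mem t).1 (or_intror (refl t))) => ht; [left|by left|by right|].
  split=> //; case: ((mem t').2 (or_intror (refl t'))) => /sy // st'.
  exact: tr _ _ _ ht (tr _ _ _ (sy _ _ hs) st').
by case: ((mem s').2 (or_introl (refl s'))) => /sy; [left | right].
Qed.

(** The usual Kuratowski argument. Since [indisc] mentions no stage, the outer and the inner pairs
    are inverted with the same [ka]. *)
Lemma indisc_opair M ka n s t s' t' : librationist M ->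
  (forall s t, M ka n (Eq s t) -> indisc M n s t) ->
  indisc M n (opair s t) (opair s' t') ->
  indisc M n s s' /\ indisc M n t t'.
Proof.
move=> hM hka; have up := indisc_upair hM hka.
have tr := @indisc_trans M n; have sy := @indisc_sym M n.
case/up => -[/up h1 /up h2].
  have ss' : indisc M n s s' by case: h1 => -[].
  split=> //; case: h2 => -[] // st' ts'.
  exact: tr _ _ _ ts' (tr _ _ _ (sy _ _ ss') st').
have [ss' st'] : indisc M n s s' /\ indisc M n s t' by case: h1 => -[].
have ts' : indisc M n t s' by case: h2 => -[].
by split=> //; exact: tr _ _ _ ts' (tr _ _ _ (sy _ _ ss') st').
Qed.

(** * Existence of varpi *)

(** If [A] held eventually along every [n], the supremum of the countably many thresholds would
    witness [IN M A]. *)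
Lemma not_IN_cofinal M A : librationist M -> ~ IN M A ->
  exists n, forall be, exists de, ole be de /\ ~ M de n A.
Proof.
move=> hM nIN; apply: NNPP => h; apply: nIN.
have ev n : exists be, forall de, ole be de -> M de n A.
  apply: NNPP => hn; apply: h; exists n => be.
  apply: NNPP => hbe; apply: hn; exists be => de le_de.
  by apply: NNPP => nA; apply: hbe; exists de.
have [f hf] := functional_choice _ ev.
exists (osucc (osup f)) => be le_be n.
have lt_be : olt (osup f) be by apply: olt_le_trans (olt_osucc _) le_be.
rewrite (lib_Tr hM); last by apply: ole_lt_trans lt_be; apply: ole0.
exists (osup f); split=> // de le_de _; apply: hf.
by apply: ole_trans le_de; apply: olt_ole; apply: olt_osup.
Qed.

Lemma exists_stabilizes_all M : librationist M -> exists al, stabilizes_all M al.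
Proof.
move=> hM.
have ex_from A : exists al, IN M A -> IN_from M al A.
  by have [[al ?]|nIN] := classic (IN M A); [exists al | exists ozero].
have [f hf] := functional_choice _ ex_from.
have ex_n A : exists n, ~ IN M A -> forall be, exists de, ole be de /\ ~ M de n A.
  have [?|/(not_IN_cofinal hM)[n hn]] := classic (IN M A); first by exists 0.
  by exists n.
have [g hg] := functional_choice _ ex_n.
have ex_h (p : formula * Ord) : exists de,
    ~ IN M p.1 -> ole p.2 de /\ ~ M de (g p.1) p.1.
  have [?|/hg/(_ p.2)[de hde]] := classic (IN M p.1); first by exists ozero.
  by exists de.
have [h hh] := functional_choice _ ex_h.
(* One step passes, for all formulas that are not [IN] simultaneously, a refutation at or above
   [be]; the iteration starts above every stage [f A] from which an [IN] formula has settled. *)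
pose next be := osup (fun A => h (A, be)).
pose al k := iter k next (osup f).
have lt_al A k : olt (h (A, al k)) (osup al).
  apply: olt_le_trans (olt_ole (olt_osup al k.+1)).
  exact: (olt_osup (fun A => h (A, al k))).
have lt0 : olt ozero (osup al) by apply: ole_lt_trans (olt_osup al 0); apply: ole0.
exists (osup al) => A _; split=> [/hf hA be le_be|hT].
  apply: hA; apply: ole_trans le_be; apply: olt_ole.
  apply: olt_le_trans (olt_osup f A) _.
  exact: olt_ole (olt_osup al 0).
(* A threshold [ga] below the limit is at most some [al k], and the refutation [h (A, al k)] lies
   between [al k] and the limit. *)
apply: NNPP => nIN; have := hT (g A); rewrite (lib_Tr hM) // => -[ga [[k le_k] hga]].
have [le_h nM] := hh (A, al k) nIN.
by apply: nM; apply: hga (lt_al A k); apply: ole_trans le_h.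
Qed.

(** Truth from [ka] on makes [B] an [IN] sentence, and varpi, by stabilizing it, already lies in the
    range where [Tr B] holds, however large [ka] is. *)
Lemma forcesM_of_eventually M ka B : librationist M -> sentence B ->
  (forall al n, ole ka al -> M al n B) -> forcesM M B.
Proof.
move=> hM sB hB; have [al /exists_least[w [sw lw]]] := exists_stabilizes_all hM.
exists w; split=> //; apply: (proj1 (sw B sB)) (ole_refl w).
exists (osucc ka) => be le_be n.
have lt_be : olt ka be by apply: olt_le_trans (olt_osucc _) le_be.
rewrite (lib_Tr hM); last by apply: ole_lt_trans lt_be; apply: ole0.
by exists ka; split=> // de le_de _; apply: hB.
Qed.

(** * The manifestation point *)

(** The common shape of the term inside [diag A], which is [selfsec (Var 0)], and of [manif A],
    which is [selfsec (diag A)], both by conversion. *)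
Definition selfsec (z : term) : term :=
  Abs (In (opair (Var 0) (tlift z)) (tlift z)).

Lemma tsub_selfsec s z : tsub s (selfsec z) = selfsec (tsub s z).
Proof.
rewrite -[LHS]/(Abs (In (tsub (upsub s) (opair (Var 0) (tlift z)))
                        (tsub (upsub s) (tlift z)))).
by rewrite tsub_opair !tsub_upsub_tlift.
Qed.

Lemma inst_app2 A s t u : fbelow 2 A ->
  inst (app2 A s t) u = app2 A (tinst s u) (tinst t u).
Proof.
move=> hA; rewrite /inst /app2 (proj2 sub_sub).
by apply: (proj2 sub_eq_below) hA _ => -[|[|i]].
Qed.

Lemma indisc_app2 M al n A y z y' z' : fbelow 2 A ->
  indisc M n y y' -> indisc M n z z' ->
  (M al n (app2 A y (selfsec z)) <-> M al n (app2 A y' (selfsec z'))).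
Proof.
(* The arguments are exchanged one at a time, with the other one held fixed by a shift. *)
move=> hA /(_ al (app2 A (Var 0) (tlift (selfsec z)))) hy.
move=> /(_ al (app2 A (tlift y') (selfsec (Var 0)))).
move: hy; rewrite !inst_app2 // !tinst_tlift => ->.
by rewrite /tinst !tsub_selfsec.
Qed.

(** The three substitutions come from opening the comprehension at [p] and then the two existential
    quantifiers at [y] and [z]. *)
Lemma inst_diag_body A p y z : fbelow 2 A ->
  fsub (sub0 z) (fsub (upsub (sub0 y)) (fsub (upsub (upsub (sub0 p)))
    (And (Eq (Var 2) (opair (Var 1) (Var 0)))
       (fren (upren (upren succn)) (app2 A (Var 1) (selfsec (Var 0))))))) =
  And (Eq p (opair y z)) (app2 A y (selfsec z)).
Proof.
move=> hA; have lift_y : tsub (sub0 z) (tlift y) = y := tinst_tlift y z.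
rewrite !fsub_And; congr And.
  rewrite !fsub_Eq !tsub_opair /= tsub_upsub_tlift.
  by rewrite -!/(tinst (tlift _) _) !tinst_tlift.
rewrite /app2 (proj2 sub_ren) !(proj2 sub_sub).
apply: (proj2 sub_eq_below) hA _ => -[|[|i]] // _.
by rewrite !tsub_selfsec.
Qed.

(** Pair inversion makes any witnesses [y], [z] indiscernible from [b] and [diag A], which turns
    [selfsec z] into [manif A]; conversely [b] and [diag A] are themselves witnesses. *)
Lemma lib_In_diag M ka al n A b : librationist M -> fbelow 2 A ->
  (forall ga s t, ole ka ga -> M ga n (Eq s t) -> indisc M n s t) ->
  olt ka al ->
  (M al n (In (opair b (diag A)) (diag A)) <->
   M al n (Tr (app2 A b (manif A)))).
Proof.
move=> hM hA hka lt_al; rewrite (lib_Abs hM); last first.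
  by apply: ole_lt_trans lt_al; apply: ole0.
apply: (lib_Tr_congr hM lt_al) => de le_de.
have hF : full (M de n) := lib_full hM de n.
have -> : manif A = selfsec (diag A) by [].
pose p := opair b (diag A).
rewrite (full_Ex _ hF); split=> [[y /(full_Ex _ hF)[z hz]]|hAb].
  have : M de n (And (Eq p (opair y z)) (app2 A y (selfsec z))).
    by rewrite -(inst_diag_body p y z hA).
  rewrite full_And // => -[/(hka _ _ _ le_de) eq_p].
  have [yb zd] := indisc_opair hM (fun s t => hka de s t le_de) eq_p.
  by rewrite (indisc_app2 de hA yb zd).
have : M de n (And (Eq p p) (app2 A b (selfsec (diag A)))).
  by rewrite full_And //; split=> //; apply: lib_Eq_refl.
rewrite -(inst_diag_body p b (diag A) hA) => hz.
by exists b; apply/(full_Ex _ hF); exists (diag A).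
Qed.

(** Closedness matters because varpi is only known to stabilize sentences. *)
Lemma tbelow_manif A : fbelow 2 A -> tbelow 0 (manif A).
Proof.
move=> hA; have bd : tbelow 0 (diag A).
  change (fbelow 1 (Ex (Ex (And (Eq (Var 2) (opair (Var 1) (Var 0)))
    (fren (upren (upren succn)) (app2 A (Var 1) (selfsec (Var 0)))))))).
  do 2!apply: fbelow_Ex; apply: fbelow_And.
    by apply: fbelow_Eq => //; apply: tbelow_opair.
  apply: (proj2 below_ren _ 2) => [|[|[|i]] //].
  by apply: (proj2 below_sub _ 2) => // -[|[|i]].
have b1 : tbelow 1 (tlift (diag A)) := tbelow_tlift bd.
change (tbelow 1 (opair (Var 0) (tlift (diag A))) && tbelow 1 (tlift (diag A))).
by apply/andP; split=> //; apply: tbelow_opair.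
Qed.

Theorem theorem16p1p3 (M : Ord -> nat -> formula -> Prop)
    (hM : librationist M) (A : formula) (hA : fbelow 2 A) :
  forcesM M
    (All (Iff (In (Var 0) (tlift (manif A)))
              (Tr (Tr (app2 A (Var 0) (tlift (manif A))))))).
Proof.
have [ka hka] := eventually_Eq_indisc hM.
(* Two successors, one for each comprehension unfolded: stages [de] from [osucc ka] on still lie
   strictly above [ka], as [lib_In_diag] demands. *)
apply: (@forcesM_of_eventually M (osucc (osucc ka))) => //.
  have bm : tbelow 1 (tlift (manif A)) by apply/tbelow_tlift/tbelow_manif.
  have bA : fbelow 1 (app2 A (Var 0) (tlift (manif A))).
    by apply: (proj2 below_sub _ 2) => // -[|[|i]].
  change (fbelow 1 (Iff (In (Var 0) (tlift (manif A)))
                        (Tr (Tr (app2 A (Var 0) (tlift (manif A))))))).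
  apply: fbelow_Iff; first exact: bm.
  change (fbelow 1 (app2 A (Var 0) (tlift (manif A))) && true && true).
  by rewrite bA.
move=> al n le_al; apply/(proj2 (lib_full hM al n)) => b.
have -> : inst (Iff (In (Var 0) (tlift (manif A)))
                    (Tr (Tr (app2 A (Var 0) (tlift (manif A)))))) b =
    Iff (In b (manif A)) (Tr (Tr (app2 A b (manif A)))).
  rewrite -[LHS]/(Iff (In b (tinst (tlift (manif A)) b))
    (Tr (Tr (inst (app2 A (Var 0) (tlift (manif A))) b)))).
  by rewrite inst_app2 // !tinst_tlift.
rewrite full_Iff; last exact: lib_full hM _ _.
have lt_al : olt (osucc ka) al by apply: olt_le_trans le_al; apply: olt_osucc.
rewrite (lib_Abs hM); last by apply: ole_lt_trans lt_al; apply: ole0.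
have -> : inst (In (opair (Var 0) (tlift (diag A))) (tlift (diag A))) b =
    In (opair b (diag A)) (diag A).
  rewrite -[LHS]/(In (tsub (sub0 b) (opair (Var 0) (tlift (diag A))))
                     (tinst (tlift (diag A)) b)).
  by rewrite tsub_opair -/(tinst (tlift _) _) !tinst_tlift.
apply: (lib_Tr_congr hM lt_al) => de le_de.
apply: (lib_In_diag b hM hA (hka ^~ n)).
by apply: olt_le_trans le_de; apply: olt_osucc.
Qed.
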